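(* The closure of $\mathcal{P}^{(3)}$ is the Sierpinski sponge $K$, i.e. the (non-empty) compact set $K\subset\mathbb{R}^3$ satisfying \[K=\frac{1}{2}K\cup\frac{1}{2}(K+(1,0,0))\cup\frac{1}{2}(K+(0,1,0))\cup\frac{1}{2}(K+(0,0,1)).\]
   Context: $\mathbb{N}$ denotes the non-negative integers, and $\oplus$ denotes the bitwise exclusive OR (Nim-sum) of non-negative integers. For $m\ge 0$ let \[P_m^{(3)}=\{(x_1,x_2,x_3)\in\mathbb{N}^3 : x_i<2^m \text{ for } 1\le i\le 3 \text{ and } x_1\oplus x_2\oplus x_3=0\}.\] The scaled sets $\frac{1}{2^m}P_m^{(3)}\subset[0,1)^3$ are increasing in $m$, and \[\mathcal{P}^{(3)}:=\lim_{m\to\infty}\frac{1}{2^m}P_m^{(3)}=\bigcup_{m=0}^{\infty}\frac{1}{2^m}P_m^{(3)}\subset\mathbb{R}^3.\] The closure is taken in $\mathbb{R}^3$. For $A\subset\mathbb{R}^3$, $u\in\mathbb{R}^3$ and $a\in\mathbb{R}$, $a(A+u):=\{a(x+u) : x\in A\}$.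
   Formalization: The translation vectors (1,0,0), (0,1,0), (0,0,1) are replaced by (0,1,1), (1,0,1), (1,1,0): every point of the closure satisfies x_1 ≤ x_2+x_3, while the equation as printed would put (1/2,0,0) in it. *)

(* Defs.v *)
From HB Require Import structures.
From mathcomp Require Import all_boot all_order all_algebra.
From mathcomp Require Import all_classical all_reals all_analysis.
Set Implicit Arguments.
Unset Strict Implicit.
Unset Printing Implicit Defensive.
Import Order.TTheory GRing.Theory Num.Theory.
Import numFieldNormedType.Exports.
Local Open Scope classical_set_scope.
Local Open Scope ring_scope.

(* Both N^3 and R^3 are row vectors of length 3; the topology on 'rV[R]_3 is
   the product topology, i.e. the usual one of R^3. *)

Definition nimP (m : nat) : set 'rV[nat]_3 :=
  [set x : 'rV[nat]_3 | (forall i : 'I_3, (x ord0 i < 2 ^ m)%N) /\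
     Nat.lxor (Nat.lxor (x ord0 0) (x ord0 1)) (x ord0 2) = 0%N].

Definition scaled_nimP (R : realType) (m : nat) : set 'rV[R]_3 :=
  [set (2 ^+ m)^-1 *: map_mx (fun n : nat => n%:R : R) x | x in nimP m].
Arguments scaled_nimP : clear implicits.

Definition nim_limit (R : realType) : set 'rV[R]_3 :=
  \bigcup_m scaled_nimP R m.
Arguments nim_limit : clear implicits.

Definition vec3 (R : realType) (a b c : R) : 'rV[R]_3 :=
  \row_(j < 3) [:: a; b; c]`_j.

Definition scale_shift (R : realType) (a : R) (A : set 'rV[R]_3)
    (u : 'rV[R]_3) : set 'rV[R]_3 :=
  [set a *: (x + u) | x in A].

(* The translation vectors are the bit triples with even sum, i.e. those that can
   occur at one binary position of a Nim-sum equal to zero: (0,0,0) and the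
   permutations of (0,1,1).  The unit vectors e_i in place of (1,1,1) - e_i would
   give the image of this attractor under a linear automorphism of R^3: it lies
   in x + y + z <= 1, whereas (2,1,3)/4 belongs to nim_limit. *)
Definition is_sierpinski_sponge (R : realType) (K : set 'rV[R]_3) : Prop :=
  [/\ K !=set0,
      compact K &
      K = scale_shift 2^-1 K 0
          `|` scale_shift 2^-1 K (vec3 0 1 1)
          `|` scale_shift 2^-1 K (vec3 1 0 1)
          `|` scale_shift 2^-1 K (vec3 1 1 0)].

(* Main.v *)
(* Splitting off the leading binary digits of a triple in [nimP m.+1] leaves a
   triple in [nimP m] and a digit triple in [nimP 1], so the countable set
   [nim_limit R] is itself a fixed point of the Hutchinson operator F, and so is its
   closure.  For uniqueness, iterating the contraction brings every point of a
   bounded set [A] with [A `<=` F A] arbitrarily close to any nonempty bounded [B]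
   with [F B `<=` B]; this applies with [nim_limit R] on either side, without
   passing to the closure. *)
Require Import Defs.
From Stdlib Require PeanoNat.
From mathcomp Require Import all_boot all_order all_algebra.
From mathcomp Require Import all_classical all_reals all_analysis.
From mathcomp Require Import ring.
Import numFieldNormedType.Exports.
Import Order.TTheory GRing.Theory Num.Theory.
Local Open Scope classical_set_scope.
Local Open Scope ring_scope.

(** The bitwise theory of [Nat.lxor] is phrased with the Stdlib operations; this lemma and the next
    two carry it over to MathComp arithmetic. *)
Lemma modulo_modn (n d : nat) : (0 < d)%N -> Nat.modulo n d = (n %% d)%N.
Proof.
move=> d0; symmetry; apply: (PeanoNat.Nat.mod_unique _ _ (n %/ d)).
  by apply/ssrnat.ltP; rewrite ltn_mod.
by rewrite multE plusE mulnC -divn_eq.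
Qed.

Lemma div_divn (n d : nat) : (0 < d)%N -> Nat.div n d = (n %/ d)%N.
Proof.
move=> d0; symmetry; apply: (PeanoNat.Nat.div_unique _ _ _ (n %% d)).
  by apply/ssrnat.ltP; rewrite ltn_mod.
by rewrite multE plusE mulnC -divn_eq.
Qed.

Lemma pow_expn (m n : nat) : Nat.pow m n = (m ^ n)%N.
Proof. by elim: n => //= n ->; rewrite expnS multE. Qed.

(** Dividing by [2 ^ m] is a right shift, which acts on each bit position separately. *)
Lemma lxor_divn (m a b : nat) :
  (Nat.lxor a b %/ 2 ^ m = Nat.lxor (a %/ 2 ^ m) (b %/ 2 ^ m))%N.
Proof.
rewrite -!div_divn ?expn_gt0 // -pow_expn -!PeanoNat.Nat.shiftr_div_pow2.
exact: PeanoNat.Nat.shiftr_lxor.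
Qed.

(** Compared bit by bit: reduction modulo [2 ^ m] keeps the bits below [m] and clears the others. *)
Lemma lxor_modn (m a b : nat) :
  (Nat.lxor a b %% 2 ^ m = Nat.lxor (a %% 2 ^ m) (b %% 2 ^ m))%N.
Proof.
rewrite -!modulo_modn ?expn_gt0 // -pow_expn; apply: PeanoNat.Nat.bits_inj => i.
rewrite PeanoNat.Nat.lxor_spec; have [im|mi] := ltnP i m.
  by rewrite !PeanoNat.Nat.mod_pow2_bits_low ?PeanoNat.Nat.lxor_spec//; apply/ssrnat.ltP.
by rewrite !PeanoNat.Nat.mod_pow2_bits_high//; apply/ssrnat.leP.
Qed.

(** The Nim-sum [n] vanishes iff its quotient and remainder by [2 ^ m] both do, and these are the
    Nim-sums of the quotients and of the remainders. *)
Lemma nimP_digit (m : nat) (a : 'rV[nat]_3) :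
  nimP m.+1 a <-> nimP m (map_mx (modn^~ (2 ^ m)%N) a) /\
                  nimP 1 (map_mx (divn^~ (2 ^ m)%N) a).
Proof.
have m0 : (0 < 2 ^ m)%N by rewrite expn_gt0.
rewrite /nimP /= !mxE -!lxor_modn -!lxor_divn; set n := Nat.lxor _ _.
split=> [[a_lt ->]|[[_ n_mod] [a_lt n_div]]].
  rewrite mod0n div0n; split; split=> // i; rewrite mxE ?ltn_mod//.
  by rewrite ltn_divLR// -expnD.
split=> [i|]; last by rewrite (divn_eq n (2 ^ m)) n_mod n_div.
by have := a_lt i; rewrite mxE ltn_divLR// -expnD.
Qed.

Definition real_mx (R : realType) (a : 'rV[nat]_3) : 'rV[R]_3 :=
  map_mx (fun n : nat => n%:R : R) a.

(** Euclidean division by [2 ^ m] turns the leading digit triple into the translation vector of one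
    of the contractions. *)
Lemma scaled_digit (R : realType) (m : nat) (a : 'rV[nat]_3) :
  (2 ^+ m.+1)^-1 *: real_mx R a =
  2^-1 *: ((2 ^+ m)^-1 *: real_mx R (map_mx (modn^~ (2 ^ m)%N) a) +
           real_mx R (map_mx (divn^~ (2 ^ m)%N) a)).
Proof.
apply/rowP => i; rewrite !mxE {1}(divn_eq (a ord0 i) (2 ^ m)).
have m0 : (2 : R) ^+ m != 0 by rewrite expf_neq0 ?pnatr_eq0.
by rewrite natrD natrM natrX exprS; field.
Qed.

Definition hutchinson {R : realType} (U A : set 'rV[R]_3) : set 'rV[R]_3 :=
  \bigcup_(u in U) scale_shift 2^-1 A u.

Lemma nimP1P (u : 'rV[nat]_3) : nimP 1 u <->
  [\/ u = 0, u = \row_j [:: 0; 1; 1]`_j, u = \row_j [:: 1; 0; 1]`_j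
    | u = \row_j [:: 1; 1; 0]`_j].
Proof.
split=> [[u_lt]|].
  have uE : u = \row_j [:: u ord0 0; u ord0 1; u ord0 2]`_j.
    apply/rowP => j; rewrite mxE.
    by case: j => -[|[|[|//]]] ? /=; congr (u _ _); apply/val_inj.
  rewrite uE !mxE /=; have := u_lt 0; have := u_lt 1; have := u_lt 2.
  (* Each coordinate is 0 or 1; of the eight triples, the four with odd sum have a nonzero
     Nim-sum. *)
  case: (u ord0 0) => [|[|//]]; case: (u ord0 1) => [|[|//]];
    case: (u ord0 2) => [|[|//]] => // _ _ _ _.
  - constructor 1; apply/rowP => j; rewrite !mxE.
    by case: j => -[|[|[|//]]] ?.
  - by constructor 2.
  - by constructor 3.
  - by constructor 4.
by case=> ->; split=> [i|]; rewrite ?mxE //; case: i => -[|[|[|//]]] ?.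
Qed.

Lemma sponge_hutchinson (R : realType) (A : set 'rV[R]_3) :
  hutchinson (real_mx R @` nimP 1) A =
  scale_shift 2^-1 A 0
  `|` scale_shift 2^-1 A (vec3 0 1 1)
  `|` scale_shift 2^-1 A (vec3 1 0 1)
  `|` scale_shift 2^-1 A (vec3 1 1 0).
Proof.
have E0 : real_mx R 0 = 0 by apply/rowP => i; rewrite !mxE.
have E (a b c : nat) :
    real_mx R (\row_j [:: a; b; c]`_j) = vec3 a%:R b%:R c%:R.
  by apply/rowP => -[[|[|[|//]]] ?]; rewrite !mxE.
rewrite /hutchinson bigcup_image; apply/seteqP; split=> x.
  move=> [u /nimP1P[] -> /=]; rewrite ?E0 ?E.
  - by move=> ?; left; left; left.
  - by move=> ?; left; left; right.
  - by move=> ?; left; right.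
  - by move=> ?; right.
move=> [[[]|]|] Ax.
- by exists 0; [apply/nimP1P; constructor 1 | rewrite E0].
- by eexists; [apply/nimP1P; constructor 2; reflexivity | rewrite E].
- by eexists; [apply/nimP1P; constructor 3; reflexivity | rewrite E].
- by eexists; [apply/nimP1P; constructor 4; reflexivity | rewrite E].
Qed.

Lemma hutchinson_nim_limit (R : realType) :
  hutchinson (real_mx R @` nimP 1) (nim_limit R) = nim_limit R.
Proof.
rewrite /hutchinson bigcup_image; apply/seteqP; split=> x.
  move=> [u u1 [_ [m _ [b [b_lt b0] <-]] <-]].
  (* Put the digit [u] back in front of the [m] binary digits of [b]. *)
  pose a : 'rV[nat]_3 := \row_i (u ord0 i * 2 ^ m + b ord0 i)%N.
  have a_mod : map_mx (modn^~ (2 ^ m)%N) a = b.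
    by apply/rowP => i; rewrite !mxE modnMDl modn_small.
  have a_div : map_mx (divn^~ (2 ^ m)%N) a = u.
    by apply/rowP => i; rewrite !mxE divnMDl ?expn_gt0// divn_small// addn0.
  exists m.+1 => //; exists a; first by apply/nimP_digit; rewrite a_mod a_div.
  by have := scaled_digit R m a; rewrite a_mod a_div.
move=> [[|m] _ [a aP <-]].
  (* At level 0 there is no digit to split off, but the only point is the origin, which the map with
     [u = 0] fixes. *)
  have a0 : a = 0.
    by apply/rowP => i; rewrite !mxE; case: aP => /(_ i); case: (a _ _).
  have E0 : real_mx R 0 = 0 by apply/rowP => i; rewrite !mxE.
  exists 0; first by apply/nimP1P; constructor 1.
  exists 0; last by rewrite a0 -/(real_mx R 0) E0 addr0 !scaler0.
  by exists 0%N => //; exists 0; rewrite -?a0// a0 -/(real_mx R 0) E0 scaler0.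
have [a_mod a_div] := (nimP_digit m a).1 aP.
exists (map_mx (divn^~ (2 ^ m)%N) a) => //.
exists ((2 ^+ m)^-1 *: real_mx R (map_mx (modn^~ (2 ^ m)%N) a)).
  by exists m => //; exists (map_mx (modn^~ (2 ^ m)%N) a).
by rewrite -scaled_digit.
Qed.

Lemma bounded_setP (R : realType) (V : normedModType R) (A : set V) :
  bounded_set A <-> exists M, forall x, A x -> `|x| <= M.
Proof.
split=> [/ex_strict_bound_gt0[M _ AM]|[M AM]].
  by exists M => x /AM/ltW.
by exists M; split=> [|N /ltW MN x /AM xM]; [exact: num_real|exact: le_trans MN].
Qed.

(** A closed ball containing [A] also contains its closure. *)
Lemma bounded_closure (R : realType) (V : normedModType R) (A : set V) :
  bounded_set A -> bounded_set (closure A).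
Proof.
move=> /bounded_setP[M AM]; apply/bounded_setP; exists M => x.
rewrite closureE => /(_ (closed_ball_ Num.Def.normr 0 M)).
rewrite /closed_ball_ /= sub0r normrN; apply; split.
  exact: closed_closed_ball_.
by move=> y /AM; rewrite /= sub0r normrN.
Qed.

Lemma hutchinson_sub_closure (R : realType) (U A B : set 'rV[R]_3) :
  bounded_set A -> bounded_set B -> B !=set0 ->
  A `<=` hutchinson U A -> hutchinson U B `<=` B -> A `<=` closure B.
Proof.
move=> /bounded_setP[M AM] /bounded_setP[N BN] [b Bb] AU UB.
(* Write [x] as the image of some [x'] in [A] and approximate [x'] by [y] in [B]; the same map sends
   [y] into [B] and halves the distance. *)
have AB n : forall x, A x -> exists2 y, B y & `|x - y| <= (M + N) / 2 ^+ n.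
  elim: n => [x Ax|n IH x /AU[u Uu [x' /IH[y By xy] <-]]].
    exists b => //; rewrite expr0 divr1 (le_trans (ler_normB _ _))//.
    by rewrite lerD ?AM ?BN.
  exists (2^-1 *: (y + u)); first by apply: UB; exists u => //; exists y.
  rewrite -scalerBr opprD addrACA subrr addr0 normrZ ger0_norm ?invr_ge0//.
  by rewrite exprS invfM mulrCA ler_wpM2l ?invr_ge0.
move=> x Ax V /nbhs_normP[e /= e0 eV].
have MN : 0 <= M + N.
  by rewrite addr_ge0 ?(le_trans _ (AM x Ax)) ?(le_trans _ (BN b Bb)).
(* The added 1 keeps the denominator positive when [M + N = 0]. *)
have d0 : 0 < e / (M + N + 1) by rewrite divr_gt0// ltr_wpDl.
have [n _ /(_ n (leqnn n))] := near_infty_natSinv_expn_lt (PosNum d0).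
rewrite /= => en.
have [y By xy] := AB n x Ax; exists y; split=> //; apply: eV.
apply: le_lt_trans xy _; move: en; rewrite ltr_pdivlMr ?ltr_wpDl// => en.
apply: le_lt_trans en; rewrite mul1r mulrC ler_wpM2l ?invr_ge0 ?exprn_ge0//.
by rewrite lerDl.
Qed.

Lemma scale_shift_continuous (R : realType) (a : R) (u : 'rV[R]_3) :
  continuous (fun x : 'rV[R]_3 => a *: (x + u)).
Proof.
move=> x; apply: (@cvgZl_tmp R 'rV[R]_3 _ (nbhs x) _ a (fun y => y + u)).
by apply: (@cvgD R 'rV[R]_3 _ (nbhs x)); [exact: cvg_id|exact: cvg_cst].
Qed.

Lemma scale_shift_compact (R : realType) (a : R) (A : set 'rV[R]_3) u :
  compact A -> compact (scale_shift a A u).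
Proof.
apply: continuous_compact; apply: continuous_subspaceT.
exact: scale_shift_continuous.
Qed.

(** Each map of the system is continuous, so it sends limits of points of [A] to limits of their
    images. *)
Lemma hutchinson_closure (R : realType) (U A : set 'rV[R]_3) :
  hutchinson U (closure A) `<=` closure (hutchinson U A).
Proof.
move=> _ [u Uu [x Ax <-]] V /(scale_shift_continuous _ _ _)/Ax[y [Ay Vy]].
by exists (2^-1 *: (y + u)); split=> //; exists u => //; exists y.
Qed.

Lemma hutchinsonS (R : realType) (U A B : set 'rV[R]_3) :
  A `<=` B -> hutchinson U A `<=` hutchinson U B.
Proof. by move=> AB x [u Uu [y /AB By <-]]; exists u => //; exists y. Qed.

Lemma nim_limit_bounded (R : realType) : bounded_set (nim_limit R).
Proof.
apply/bounded_setP; exists 1 => x [m _ [a [a_lt _] <-]] /=; set y := _ *: _.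
(* The sup norm is zero or attained at an entry, and every entry lies between 0 and 1. *)
have [y0|/mx_norm_neq0[[i j] yE]] := eqVneq (mx_norm y) 0.
  by rewrite [leLHS]/Num.Def.normr /= y0.
rewrite [leLHS]/Num.Def.normr /= yE /= !mxE ger0_norm ?mulr_ge0 ?invr_ge0 ?exprn_ge0//.
by rewrite ler_pdivrMl ?exprn_gt0// mulr1 -natrX ler_nat ltnW// (ord1 i).
Qed.

Theorem corollary5 (R : realType) :
  is_sierpinski_sponge (closure (nim_limit R)) /\
  (forall K : set 'rV[R]_3,
     is_sierpinski_sponge K -> K = closure (nim_limit R)).
Proof.
set P := nim_limit R; set U := real_mx R @` nimP 1.
have P_fix : hutchinson U P = P := hutchinson_nim_limit R.
have P_bnd : bounded_set P := @nim_limit_bounded R.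
have P_neq0 : P !=set0.
  exists 0; exists 0%N => //; exists 0; last first.
    by apply/rowP => i; rewrite !mxE mulr0.
  by split=> [i|]; rewrite !mxE.
have closed_cpt (A : set 'rV[R]_3) : compact A -> closed A.
  by apply: compact_closed; exact: norm_hausdorff.
have cP_cpt : compact (closure P).
  apply: bounded_closed_compact; first exact: bounded_closure.
  exact: closed_closure.
split=> [|K [K_neq0 K_cpt]].
  split=> //; first by have [x Px] := P_neq0; exists x; exact: subset_closure.
  rewrite -sponge_hutchinson -/U; apply/seteqP; split; last first.
    by rewrite -{2}P_fix; exact: hutchinson_closure.
  (* A finite union of compact images is closed; as it contains [P], it contains [closure P]. *)
  have : closed (hutchinson U (closure P)).
    apply: closed_cpt; rewrite /U sponge_hutchinson.
    by do !apply: compactU; exact: scale_shift_compact.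
  move/(closure_id _).1 => ->; apply: closureS.
  by rewrite -{1}P_fix; apply: hutchinsonS; exact: subset_closure.
rewrite -sponge_hutchinson -/U => K_fix.
have K_bnd : bounded_set K := compact_bounded K_cpt.
(* [K] and [P] are both bounded nonempty fixed points, so each lies in the closure of the other, and
   [K] is closed. *)
apply/seteqP; split.
  by apply: (@hutchinson_sub_closure _ U); rewrite -?K_fix ?P_fix.
have KE : K = closure K by apply/closure_id; exact: closed_cpt.
have PK : P `<=` closure K.
  by apply: (@hutchinson_sub_closure _ U); rewrite -?K_fix ?P_fix.
by move=> x /(closureS PK); rewrite -!KE.
Qed.
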